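(* Let $r\geq3$ and $s\geq2$ be integers. Let $\Gamma$ be a finite connected bipartite graph with ordered bipartition $(B|B')$ that is not complete bipartite, let $1\neq N\lhd G\leq\mathrm{Aut}(\Gamma)$, and suppose that $\Gamma$ is $r$-starlike relative to $N$ and locally $(G,s)$-distance transitive. Then $s\leq4$. Moreover, if $s=4$, then the adjacency design $\mathcal{D}(\Gamma)$ is $N$-nicely affine with $r$ parallel classes of blocks, and $\Gamma$ has diameter $4$.
   Context: All graphs are finite, simple and without loops. Locally $(G,s)$-distance transitive: the graph has diameter at least $s$, $G$ is a subgroup of its automorphism group, and for each vertex $v$ and each $1\leq i\leq s$ the stabiliser $G_v$ is transitive on the set of vertices at distance $i$ from $v$. $r$-starlike: a connected bipartite graph with ordered bipartition $(B|B')$ is $r$-starlike relative to $N$ if $N\leq\mathrm{Aut}(\Gamma)$, $N$ is transitive on $B$, and $N$ has exactly $r$ orbits on $B'$. The adjacency design $\mathcal{D}(\Gamma)$ has point set $B$ and block set $B'$, a point and a block being incident if and only if they are adjacent in $\Gamma$. Automorphisms of a design are permutations of points and blocks preserving points, blocks and incidence. $N$-nicely affine: $N$ is a group of automorphisms of the design transitive on points, and there is a constant $\mu$ such that distinct blocks are incident with exactly $\mu$ common points if they are in different $N$-orbits and with no common point if they are in the same $N$-orbit. The $N$-orbits on blocks are the parallel classes. *)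

(* Defs.v *)
From mathcomp Require Import all_boot all_fingroup.

Set Implicit Arguments.
Unset Strict Implicit.
Unset Printing Implicit Defensive.

Section Graphs.

Variable T : finType.
Implicit Types (e : rel T) (B : {set T}) (G N : {group {perm T}}).

Definition simple_graph e : Prop := symmetric e /\ irreflexive e.

Definition connected_graph e : Prop := forall x y : T, connect e x y.

Definition bipartition e B B' : Prop :=
  [/\ B :|: B' = [set: T], [disjoint B & B'] &
      forall x y : T, e x y ->
        (x \in B) && (y \in B') || (x \in B') && (y \in B)].

Definition complete_bipartite e B B' : Prop :=
  bipartition e B B' /\ {in B & B', forall x y, e x y}.

Definition graph_aut e : {set {perm T}} :=
  [set g : {perm T} | [forall x, forall y, e (g x) (g y) == e x y]].

Definition has_walk e (x y : T) (n : nat) : bool :=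
  [exists p : n.-tuple T, path e x p && (last x p == y)].

(* The least length of a walk from x to y; a shortest walk has fewer than #|T|
   edges, and the value is #|T| when y is not reachable from x. *)
Definition dist e (x y : T) : nat := find (has_walk e x y) (iota 0 #|T|).

Definition diameter e : nat := \max_(x : T) \max_(y : T) dist e x y.

Definition sphere e (v : T) (i : nat) : {set T} := [set w | dist e v w == i].

(* Transitivity on the spheres is not stated with [transitive _, on _ | _],
   which is false on the empty set: some vertices may have eccentricity less
   than s even though the diameter is at least s. *)
Definition locally_distance_transitive e G (s : nat) : Prop :=
  [/\ s <= diameter e, G \subset graph_aut e &
      forall (v : T) (i : nat), 1 <= i <= s ->
        {in sphere e v i &, forall w w', w' \in orbit 'P 'C_G[v | 'P] w}].

Definition starlike e B B' N (r : nat) : Prop :=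
  [/\ connected_graph e, bipartition e B B', N \subset graph_aut e,
      [transitive N, on B | 'P] & #|orbit 'P N @: B'| = r].

End Graphs.

(* Points and blocks are elements of a common type, so that a single
   permutation acts on both. *)
Record design (T : finType) := Design {
  points : {set T};
  blocks : {set T};
  incident : rel T (* meaningful on pairs (point, block) only *)
}.

Section Designs.

Variable T : finType.
Implicit Types (D : design T) (N : {group {perm T}}).

Definition design_aut D : {set {perm T}} :=
  [set g : {perm T} |
    [&& perm_on (points D :|: blocks D) g,
        g @: points D == points D, g @: blocks D == blocks D &
        [forall p in points D, forall b in blocks D,
           incident D (g p) (g b) == incident D p b]]].

Definition parallel_classes D N : {set {set T}} := orbit 'P N @: blocks D.

Definition nicely_affine D N : Prop :=
  [/\ N \subset design_aut D, [transitive N, on points D | 'P] &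
      exists mu : nat, {in blocks D &, forall b c, b != c ->
        #|[set p in points D | incident D p b && incident D p c]|
          = if c \in orbit 'P N b then 0 else mu}].

Definition adjacency_design (e : rel T) (B B' : {set T}) : design T :=
  Design B B' e.

End Designs.

(* Main.v *)
(** Let [b] be a block.  A point of [b] lies on blocks of every [N]-orbit, so
    transitivity of the stabiliser of [b] on its 2-sphere forces blocks of the same
    [N]-orbit to be disjoint.  As [e] is not complete bipartite, some block in the
    orbit of [b] is at distance 4 from [b]; hence, for [s >= 4], the whole 4-sphere
    of [b] lies in that orbit.  In other words, if [b] meets [c], [c] meets [d] and
    [d] is outside the orbit of [b], then [b] meets [d].  Detours through a third
    orbit then show that blocks in different orbits always meet, which bounds the
    diameter by 4. *)
Require Import Defs.
From mathcomp Require Import all_boot all_fingroup.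

Set Implicit Arguments.
Unset Strict Implicit.
Unset Printing Implicit Defensive.

(** * Walks, distances and the diameter *)

Section Walks.

Variables (T : finType) (e : rel T).
Implicit Types x y z : T.

Lemma has_walk0 x y : has_walk e x y 0 = (x == y).
Proof.
apply/existsP/idP => [[p]|xy]; first by rewrite tuple0.
by exists [tuple].
Qed.

Lemma has_walkS x y n :
  has_walk e x y n.+1 = [exists z, e x z && has_walk e z y n].
Proof.
apply/existsP/existsP => [[p]|[z /andP[exz /existsP[p /andP[pz pl]]]]].
  case/tupleP: p => z p /= /andP[/andP[exz pz] pl].
  by exists z; rewrite exz; apply/existsP; exists p; rewrite pz.
by exists [tuple of z :: p]; rewrite /= exz pz.
Qed.

Lemma has_walk_cons x y z n :
  e x z -> has_walk e z y n -> has_walk e x y n.+1.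
Proof.
by move=> exz zy; rewrite has_walkS; apply/existsP; exists z; rewrite exz.
Qed.

Lemma has_walk1 x y : has_walk e x y 1 = e x y.
Proof.
rewrite has_walkS; apply/existsP/idP => [[z]|exy].
  by rewrite has_walk0 => /andP[exz /eqP <-].
by exists y; rewrite exy has_walk0 eqxx.
Qed.

Lemma dist_le x y n : has_walk e x y n -> dist e x y <= n.
Proof.
move=> wn; rewrite leqNgt; apply/negP => lt_n.
(* [find] never exceeds the length of the list, so [n] is a valid index, and a search that went past
   [n] would have missed a walk. *)
have n_lt : n < #|T|.
  by apply: leq_trans lt_n _; rewrite -[X in _ <= X](size_iota 0) find_size.
by have := before_find 0 lt_n; rewrite nth_iota // add0n wn.
Qed.

(** A path without repeated vertices has fewer than [#|T|] edges, so the search defining [dist]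
    succeeds and does not return its default value [#|T|]. *)
Lemma dist_walk x y : connect e x y -> has_walk e x y (dist e x y).
Proof.
case/connectP => p0 /shortenP[p ep up _] -> {p0}.
set y0 := last x p.
have hw : has_walk e x y0 (size p).
  by apply/existsP; exists (in_tuple p); rewrite ep eqxx.
have lt_p : size p < #|T| 
  by have /card_uniqP/= <- := up; apply: max_card.
have hh : has (has_walk e x y0) (iota 0 #|T|).
  by apply/hasP; exists (size p); rewrite ?mem_iota.
have := nth_find 0 hh; rewrite nth_iota ?add0n //.
by move: hh; rewrite has_find size_iota.
Qed.

Lemma diameter_le n :
  (forall x y, exists2 m, m <= n & has_walk e x y m) -> diameter e <= n.
Proof.
move=> hw; apply/bigmax_leqP => x _; apply/bigmax_leqP => y _.
by have [m mn /dist_le] := hw x y; move/leq_trans; apply.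
Qed.

Lemma connected_ind (P : T -> Prop) x :
  connected_graph e -> P x -> (forall y z, P y -> e y z -> P z) ->
  forall y, P y.
Proof.
move=> conn Px Pe y; case/connectP: (conn x y) => p + ->.
by elim: p x Px => //= z p IH x Px /andP[/(Pe _ _ Px) Pz /(IH _ Pz)].
Qed.

End Walks.

(** * Common neighbours and the action of automorphisms *)

Definition meet (T : finType) (e : rel T) (b c : T) : bool :=
  [exists v, e v b && e v c].

Definition common_nbrs (T : finType) (e : rel T) (b c : T) : {set T} :=
  [set v | e v b && e v c].

Lemma aut_edge (T : finType) (e : rel T) (g : {perm T}) x y :
  g \in graph_aut e -> e (g x) (g y) = e x y.
Proof. by rewrite inE => /forallP/(_ x)/forallP/(_ y)/eqP. Qed.

Lemma card_common_nbrs (T : finType) (e : rel T) (g : {perm T}) b c :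
  g \in graph_aut e -> #|common_nbrs e (g b) (g c)| = #|common_nbrs e b c|.
Proof.
move=> ge; rewrite -[RHS](card_imset _ (@perm_inj _ g)); congr #|pred_of_set _|.
apply/setP => v; apply/idP/imsetP => [|[u + ->]]; last by rewrite !inE !aut_edge.
rewrite inE => /andP[vb vc]; exists ((g^-1)%g v); last by rewrite permKV.
by rewrite inE -(aut_edge _ b ge) -(aut_edge _ c ge) permKV vb.
Qed.

Lemma mem_orbit_permP (T : finType) (H : {group {perm T}}) (x y : T) :
  reflect (exists2 n : {perm T}, n \in H & y = n x) (y \in orbit 'P H x).
Proof.
apply: (iffP (@orbitP _ _ _ _ _ _ _)) => [[n nH <-]|[n nH ->]];
by exists n.
Qed.

(** If [n] carries [x] to [y], its conjugate [n ^ g], again in [N], carries [g x] to [g y]. Hence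
    [G] permutes the [N]-orbits. *)
Lemma normal_orbit (T : finType) (G N : {group {perm T}}) (g : {perm T}) x y :
  (N <| G)%g -> g \in G -> y \in orbit 'P N x -> g y \in orbit 'P N (g x).
Proof.
move=> /andP[_ nNG] gG /mem_orbit_permP[n nN ->]; apply/mem_orbit_permP.
by exists (n ^ g)%g; rewrite ?permJ // memJ_norm // (subsetP nNG).
Qed.

(** * Points, blocks and the [N]-orbits on blocks *)

Section Starlike.

Variables (T : finType) (e : rel T) (B B' : {set T}).
Variables (G N : {group {perm T}}) (s : nat).
Hypothesis esym : symmetric e.
Hypothesis conn : connected_graph e.
Hypothesis bip : bipartition e B B'.
Hypothesis ncb : ~ complete_bipartite e B B'.
Hypothesis nNG : (N <| G)%g.
Hypothesis Ntr : [transitive N, on B | 'P].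
Hypothesis many_orbits : 2 < #|orbit 'P N @: B'|.
Hypothesis ldt : locally_distance_transitive e G s.
Hypothesis s_ge2 : 2 <= s.

Implicit Types b c d f : T.

Let autG g : g \in G -> g \in graph_aut e.
Proof. by case: ldt => _ /subsetP sub _ /sub. Qed.

Let autN g : g \in N -> g \in graph_aut e.
Proof. by move/(subsetP (normal_sub nNG)); apply: autG. Qed.

Lemma notin_blocks x : (x \notin B') = (x \in B).
Proof.
case: bip => cov dis _; apply/idP/idP => [xB'|xB].
  by have := in_setT x; rewrite -cov inE (negPf xB') orbF.
by rewrite (disjointFr dis xB).
Qed.

Lemma edge_bip x y : e x y -> (x \in B') = (y \in B).
Proof.
case: bip => _ _ /(_ x y) H /H /orP[] /andP[].
  by rewrite -notin_blocks => /negPf-> yB'; rewrite -notin_blocks yB'.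
by move=> -> ->.
Qed.

Lemma edge_point v b : b \in B' -> e v b -> v \in B.
Proof. by rewrite esym => bB' /edge_bip; rewrite bB' => <-. Qed.

Lemma edge_block v b : v \in B -> e v b -> b \in B'.
Proof. by rewrite esym => vB /edge_bip ->. Qed.

Lemma has_walk_parity n x y :
  has_walk e x y n -> (x \in B') = (y \in B') (+) odd n.
Proof.
elim: n x => [|n IH] x; first by rewrite has_walk0 addbF => /eqP ->.
rewrite has_walkS => /existsP[z /andP[/edge_bip -> /IH]].
by rewrite -notin_blocks => -> /=; rewrite addbN.
Qed.

Lemma meetP b c : reflect (exists2 v, e v b & e v c) (meet e b c).
Proof.
apply: (iffP existsP) => [[v /andP[]]|[v vb vc]]; first by exists v.
by exists v; rewrite vb.
Qed.

Lemma meet_sym b c : meet e b c = meet e c b.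
Proof. by apply/meetP/meetP => -[v]; exists v. Qed.

Lemma meet_block b c : b \in B' -> meet e b c -> c \in B'.
Proof. by move=> bB' /meetP[v /(edge_point bB')/edge_block] /[apply]. Qed.

Lemma has_walk_meet b c : has_walk e b c 2 = meet e b c.
Proof.
rewrite has_walkS; apply: eq_existsb => v.
by rewrite has_walk1 esym.
Qed.

Lemma block_point b : b \in B' -> exists2 v, v \in B & e v b.
Proof.
move=> bB'; case/imsetP: Ntr => x xB _.
case/connectP: (conn b x) => -[_ /= xb|v p /= /andP[ebv _] _].
  by move: xB; rewrite -notin_blocks xb bB'.
by exists v; rewrite 1?esym // -(edge_bip ebv).
Qed.

(** An element of [N] moving some point of [b] to [v] moves [b] to a block on [v]. *)
Lemma point_meets_orbit v b :
  v \in B -> b \in B' -> exists2 c, c \in orbit 'P N b & e v c.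
Proof.
move=> vB /block_point[u uB eub].
have /mem_orbit_permP[n nN ->] : v \in orbit 'P N u by rewrite (atransP Ntr).
by exists (n b); [apply/mem_orbit_permP; exists n | rewrite aut_edge ?autN].
Qed.

(** Two orbits cannot exhaust a set of at least three. This is where [r >= 3] enters. *)
Lemma other_orbit b c : exists d,
  [/\ d \in B', d \notin orbit 'P N b & d \notin orbit 'P N c].
Proof.
have /subsetPn[_ /imsetP[d dB' ->]] :
    ~~ (orbit 'P N @: B' \subset [set orbit 'P N b; orbit 'P N c]).
  apply/negP => /subset_leq_card; rewrite leqNgt => /negP; apply.
  by apply: leq_ltn_trans many_orbits; rewrite cards2; case: (_ != _).
by rewrite !inE negb_or !orbit_eq_mem => /andP[db dc]; exists d.
Qed.

Lemma point_other_orbit v b c : v \in B ->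
  exists d, [/\ e v d, d \notin orbit 'P N b & d \notin orbit 'P N c].
Proof.
move=> vB; have [d0 [d0B' d0b d0c]] := other_orbit b c.
have [d dd0 evd] := point_meets_orbit vB d0B'.
by exists d; rewrite evd -!orbit_eq_mem (orbit_eqP dd0) !orbit_eq_mem.
Qed.

(** * Consequences of transitivity on spheres of radius 1 and 2 *)

Lemma stab_transitive v w w' i : 1 <= i <= s ->
  dist e v w = i -> dist e v w' = i ->
  exists g, [/\ g \in G, g v = v & w' = g w].
Proof.
case: ldt => _ _ /(_ v i) /[apply] tr vw vw'.
have := tr w w'; rewrite !inE vw vw' eqxx => /(_ isT isT).
case/orbitP => g; rewrite inE => /andP[gG /astab1P gv] <-.
by exists g.
Qed.

Lemma dist_meet b c : b \in B' -> meet e b c -> b != c -> dist e b c = 2.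
Proof.
move=> bB' bc nbc; have cB' := meet_block bB' bc.
move: bc; rewrite -has_walk_meet => /dist_le.
case E: (dist e b c) (dist_walk (conn b c)) => [|[|[|]]] //.
  by rewrite has_walk0 (negPf nbc).
by move/has_walk_parity; rewrite bB' cB'.
Qed.

(** A walk of length 4 passes through [c]; parity excludes 1 and 3, and the last two hypotheses
    exclude 0 and 2. *)
Lemma dist_meet2 b c d : b \in B' -> meet e b c -> meet e c d ->
  b != d -> ~~ meet e b d -> dist e b d = 4.
Proof.
move=> bB' bc cd nbd mbd.
have dB' := meet_block (meet_block bB' bc) cd.
have : dist e b d <= 4.
  case/meetP: bc cd => v; rewrite esym => ebv evc; rewrite -has_walk_meet => cd.
  exact: dist_le (has_walk_cons ebv (has_walk_cons evc cd)).
have := dist_walk (conn b d).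
case E: (dist e b d) => [|[|[|[|[|]]]]] //.
- by rewrite has_walk0 (negPf nbd).
- by move/has_walk_parity; rewrite bB' dB'.
- by rewrite has_walk_meet (negPf mbd).
- by move/has_walk_parity; rewrite bB' dB'.
Qed.

Lemma orbit_disjoint b c :
  b \in B' -> c \in orbit 'P N b -> b != c -> ~~ meet e b c.
Proof.
move=> bB' cb nbc; apply/negP => mbc; case/meetP: (mbc) => v evb evc.
have [d [evd db _]] := point_other_orbit b b (edge_point bB' evb).
have nbd : b != d by apply: contraNneq db => <-; apply: orbit_refl.
have mbd : meet e b d by apply/meetP; exists v.
(* Both [c] and [d] lie on the 2-sphere of [b], but the stabiliser of [b] preserves the orbit of
   [b], which contains [c] and not [d]. *)
have [g [gG gb dgc]] := stab_transitive (i := 2) s_ge2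
  (dist_meet bB' mbc nbc) (dist_meet bB' mbd nbd).
by case/negP: db; rewrite dgc -gb (normal_orbit nNG).
Qed.

(** First [N] moves a point of [b] to a point [w] of [c]; then the stabiliser of [w] moves the image
    of [b] to [c] within the 1-sphere of [w]. *)
Lemma blocks_transitive b c :
  b \in B' -> c \in B' -> exists2 g, g \in G & c = g b.
Proof.
move=> bB' cB'; have [v vB evb] := block_point bB'.
have [w wB ewc] := block_point cB'.
have /mem_orbit_permP[n nN wv] : w \in orbit 'P N v by rewrite (atransP Ntr).
have nG : n \in G by apply: (subsetP (normal_sub nNG)).
have dist1 x : e w x -> dist e w x = 1.
  move=> ewx; have := ewx; rewrite -has_walk1 => /dist_le.
  case E: (dist e w x) (dist_walk (conn w x)) => [|[|]] //.
  rewrite has_walk0 => /eqP wx.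
  by have := edge_bip ewx; rewrite -wx -notin_blocks; case: (w \in B').
have ewnb : e w (n b) by rewrite wv aut_edge ?autG.
have [g [gG _ ->]] :=
  stab_transitive (i := 1) (ltnW s_ge2) (dist1 _ ewnb) (dist1 _ ewc).
by exists (n * g)%g; rewrite ?groupM ?permM.
Qed.

Lemma block_full b : b \in B' ->
  (forall c w, meet e b c -> e w c -> e w b) -> {in B, forall x, e x b}.
Proof.
move=> bB' sub.
(* This invariant passes along edges: a block on a point of [b] meets [b], and by [sub] the points
   of a block meeting [b] lie on [b]. *)
have key : forall x, if x \in B then e x b else meet e b x.
  apply: (connected_ind conn (x := b)) => [|y z].
    rewrite -notin_blocks bB' /=; have [v _ evb] := block_point bB'.
    by apply/meetP; exists v.
  move=> + eyz; rewrite -notin_blocks (edge_bip eyz).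
  case: (z \in B) => /= [/sub|eyb]; first by apply; rewrite esym.
  by apply/meetP; exists y.
by move=> x xB; have := key x; rewrite xB.
Qed.

(** Otherwise [b] would contain all points by [block_full]; as [G] is transitive on blocks, so would
    every block, and the graph would be complete bipartite. *)
Lemma escaping_block b : b \in B' ->
  exists c w, [/\ meet e b c, e w c & ~~ e w b].
Proof.
move=> bB'; have [/existsP[c /existsP[w /and3P[*]]]|none] := boolP
  [exists c, exists w, [&& meet e b c, e w c & ~~ e w b]]; first by exists c, w.
case: ncb; split => // x c xB cB'.
have full : {in B, forall x, e x b}.
  apply: block_full => // d w bd ewd; apply: contraR none => ewb.
  by apply/existsP; exists d; apply/existsP; exists w; rewrite bd ewd.
(* With equal arguments, [common_nbrs e d d] is the set of points of the block [d]. *)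
have nbrs_sub d : d \in B' -> common_nbrs e d d \subset B.
  by move=> dB'; apply/subsetP => w; rewrite inE andbb => /(edge_point dB').
have nbrs_b : B \subset common_nbrs e b b.
  by apply/subsetP => w /full; rewrite inE andbb.
have [g gG cgb] := blocks_transitive bB' cB'.
have: x \in common_nbrs e c c; last by rewrite inE andbb.
have /eqP-> // : common_nbrs e c c == B.
rewrite eqEcard nbrs_sub //= cgb card_common_nbrs ?autG //.
exact: subset_leq_card.
Qed.

(** An element of [G] takes [b] to [b0], and the stabiliser of [b0] then takes the image of [c] to
    [c0] on the 2-sphere. The common value becomes the constant [mu]. *)
Lemma card_meeting b c b0 c0 : b \in B' -> b0 \in B' ->
  meet e b c -> b != c -> meet e b0 c0 -> b0 != c0 ->
  #|common_nbrs e b c| = #|common_nbrs e b0 c0|.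
Proof.
move=> bB' b0B' bc nbc bc0 nbc0; have [g gG bg] := blocks_transitive bB' b0B'.
have bgc : meet e b0 (g c).
  case/meetP: bc => v vb vc; apply/meetP.
  by exists (g v); rewrite ?bg aut_edge ?autG.
have nbgc : b0 != g c by rewrite bg (inj_eq perm_inj).
have [h [hG hb0 ->]] := stab_transitive (i := 2) s_ge2
  (dist_meet b0B' bgc nbgc) (dist_meet b0B' bc0 nbc0).
by rewrite -{1}hb0 card_common_nbrs ?autG // bg card_common_nbrs ?autG.
Qed.

(** * Transitivity on 4-spheres *)

Section FourSphere.

Hypothesis s_ge4 : 4 <= s.

Lemma meet_trans b c d : b \in B' -> meet e b c -> meet e c d ->
  d \notin orbit 'P N b -> meet e b d.
Proof.
move=> bB' bc cd; apply: contraR => nbd.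
have [c1 [w [bc1 ewc1 ewb]]] := escaping_block bB'.
have wB := edge_point (meet_block bB' bc1) ewc1.
(* The block [d1] is a vertex of the 4-sphere of [b] in the orbit of [b]: it passes through [w],
   which is off [b], and is disjoint from [b] by [orbit_disjoint]. *)
have [d1 d1b ewd1] := point_meets_orbit wB bB'.
have nbd1 : b != d1 by apply: contraNneq ewb => ->.
have c1d1 : meet e c1 d1 by apply/meetP; exists w.
have neq_bd : b != d.
  (* Having a point, [b] meets itself. *)
  apply: contraNneq nbd => <-; have [v _ evb] := block_point bB'.
  by apply/meetP; exists v.
have [g [gG gb ->]] := stab_transitive (i := 4) s_ge4
  (dist_meet2 bB' bc1 c1d1 nbd1 (orbit_disjoint bB' d1b nbd1))
  (dist_meet2 bB' bc cd neq_bd nbd).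
by rewrite -gb (normal_orbit nNG).
Qed.

Lemma blocks_linked b f :
  b \in B' -> f \in B' -> exists2 c, meet e b c & meet e c f.
Proof.
move=> bB'; pose linked f := exists2 c, meet e b c & meet e c f.
have step f1 f2 : linked f1 -> meet e f1 f2 -> linked f2.
  case=> c bc cf1 f12; have cB' := meet_block bB' bc.
  have f1B' := meet_block cB' cf1.
  have [f1b|f1b] := boolP (f1 \in orbit 'P N b); last first.
    by exists f1 => //; apply: meet_trans bc cf1 f1b.
  case/meetP: cf1 => w ewc ewf1.
  (* Here [f1] is in the orbit of [b], so the link is rerouted through a block [h] on [w] outside
     the orbits of [b] and [f2]: [meet_trans] applies to [b], [c], [h] and to [h], [f1], [f2]. *)
  have [h [ewh hb hf2]] := point_other_orbit b f2 (edge_point cB' ewc).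
  have hB' := edge_block (edge_point cB' ewc) ewh.
  have bh : meet e b h.
    by apply: meet_trans bc _ hb => //; apply/meetP; exists w.
  exists h => //; apply: meet_trans f12 _ => //; first by apply/meetP; exists w.
  by rewrite orbit_sym.
have [v0 v0B ev0b] := block_point bB'.
have bb : meet e b b by apply/meetP; exists v0.
(* The induction runs over all vertices, so points need a statement too: all blocks through them are
   linked to [b]. *)
suff key x : if x \in B' then linked x else forall f, e x f -> linked f.
  by move=> fB'; have := key f; rewrite fB'.
move: x; apply: (connected_ind conn (x := b)); first by rewrite bB'; exists b.
move=> y z + eyz; rewrite (edge_bip eyz) -notin_blocks.
case: (z \in B') => /= [/(_ z eyz) //|ly f1 ezf1].
by apply: step ly _; apply/meetP; exists z => //; rewrite esym.
Qed.

Lemma orbits_meet b c :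
  b \in B' -> c \in B' -> c \notin orbit 'P N b -> meet e b c.
Proof.
move=> bB' cB' cb; have [d bd dc] := blocks_linked bB' cB'.
exact: meet_trans bd dc cb.
Qed.

(** Some block on [x] lies outside the orbit of [b] and therefore meets [b]. *)
Lemma block_point_walk b x : b \in B' -> x \in B -> has_walk e b x 3.
Proof.
move=> bB' xB; have [c [exc cb _]] := point_other_orbit b b xB.
have /meetP[v evb evc] := orbits_meet bB' (edge_block xB exc) cb.
apply: (has_walk_cons (z := v)); first by rewrite esym.
by rewrite has_walk_meet; apply/meetP; exists c; rewrite esym.
Qed.

Lemma diameter_le4 : diameter e <= 4.
Proof.
apply: diameter_le => x y.
have [xB'|] := boolP (x \in B'); have [yB'|] := boolP (y \in B').
- exists 4 => //; have [c /meetP[v evx evc] cy] := blocks_linked xB' yB'.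
  apply: (has_walk_cons (z := v)); first by rewrite esym.
  by apply: has_walk_cons evc _; rewrite has_walk_meet.
- by rewrite notin_blocks => yB; exists 3 => //; apply: block_point_walk.
- rewrite notin_blocks => xB; exists 3 => //.
  have [c [exc cy _]] := point_other_orbit y y xB.
  apply: (has_walk_cons exc); rewrite has_walk_meet meet_sym.
  exact: orbits_meet (edge_block xB exc) cy.
- rewrite !notin_blocks => yB xB; exists 4 => //.
  have [b [exb _ _]] := point_other_orbit x x xB.
  exact: has_walk_cons exb (block_point_walk (edge_block xB exb) yB).
Qed.

Lemma adjacency_nicely_affine : nicely_affine (adjacency_design e B B') N.
Proof.
have [cov _ _] := bip.
have NB : [acts N, on B | 'P] := atrans_acts Ntr.
split=> //.
  apply/subsetP => n nN.
  have nB : n \in ('N(B | 'P))%g := subsetP NB n nN.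
  have nB' : n \in ('N(B' | 'P))%g.
    (* A permutation preserving [B] preserves its complement. *)
    have -> : B' = ~: B by apply/setP => x; rewrite inE -notin_blocks negbK.
    by rewrite astabsC.
  rewrite inE /=; apply/and4P; split.
  - by apply/subsetP => x _; rewrite cov inE.
  - by apply/eqP; exact: (astabs_setact nB).
  - by apply/eqP; exact: (astabs_setact nB').
  - by apply/forall_inP => p _; apply/forall_inP => b _; rewrite aut_edge ?autN.
have/set0Pn[v vB] : B != set0.
  by case/imsetP: Ntr => x xB _; apply/set0Pn; exists x.
(* Two blocks [b0] and [c0] through [v] in different orbits serve as the reference pair for [mu]. *)
have [b0 [ev0b0 _ _]] := point_other_orbit v v vB.
have [c0 [ev0c0 c0b0 _]] := point_other_orbit b0 b0 vB.
have b0B' := edge_block vB ev0b0.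
exists #|common_nbrs e b0 c0| => b c /= bB' cB' nbc.
have -> : [set p in B | e p b && e p c] = common_nbrs e b c.
  apply/setP => p; rewrite !inE andbC.
  by case: (boolP (e p b)) => //= /(edge_point bB') ->; rewrite andbT.
have [cb|cb] := boolP (c \in orbit 'P N b).
  apply/eqP; rewrite cards_eq0 -subset0; apply/subsetP => p.
  rewrite inE => /andP[pb pc]; case/negP: (orbit_disjoint bB' cb nbc).
  by apply/meetP; exists p.
apply: card_meeting => //; first exact: orbits_meet.
  by apply/meetP; exists v.
by apply: contraNneq c0b0 => <-; apply: orbit_refl.
Qed.

End FourSphere.

End Starlike.

Theorem proposition4p5 (T : finType) (e : rel T) (B B' : {set T})
    (G N : {group {perm T}}) (r s : nat)
    (hr : 3 <= r) (hs : 2 <= s)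
    (he : simple_graph e) (hconn : connected_graph e)
    (hbip : bipartition e B B')
    (hncb : ~ complete_bipartite e B B')
    (hG : G \subset graph_aut e)
    (hN : (N <| G)%g) (hN1 : N :!=: 1%g)
    (hstar : starlike e B B' N r)
    (hdt : locally_distance_transitive e G s) :
  s <= 4 /\
  (s = 4 ->
     [/\ nicely_affine (adjacency_design e B B') N,
         #|parallel_classes (adjacency_design e B B') N| = r
       & diameter e = 4]).
Proof.
have [esym _] := he; have [_ _ _ Ntr rE] := hstar.
have many : 2 < #|orbit 'P N @: B'| by rewrite rE.
have [s_diam _ _] := hdt.
have diam4 : 4 <= s -> diameter e <= 4.
  exact: (diameter_le4 esym hconn hbip hncb hN Ntr many hdt hs).
split=> [|s4].
  (* If [4 <= s], then [s <= diameter e <= 4]. *)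
  by have /orP[//|/diam4] := leq_total s 4; apply: leq_trans.
have s_ge4 : 4 <= s by rewrite s4.
split=> //; last by apply/eqP; rewrite eqn_leq diam4 //= -{1}s4.
exact: (adjacency_nicely_affine esym hconn hbip hncb hN Ntr many hdt hs s_ge4).
Qed.
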